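(* Let $p>1$, $a>0$, $q>0$ satisfy $$M:=\frac{p-1}{2}a-\frac{q}{2}+1>0,$$ and let $B>0$. Then there exists a positive constant $C_0=C_0(p,a,q,B)$, depending only on $p,a,q,B$, such that the following holds. Let $A,R,T_0>0$ be constants, let $0<T\le\infty$, and let $F\in C^2([0,T))$ be a real-valued function satisfying $$F(t)\ge A t^a\quad\text{for } T_0\le t<T,$$ $$F''(t)\ge B(t+R)^{-q}|F(t)|^p\quad\text{for } 0\le t<T,$$ $$F(0)\ge 0,\qquad F'(0)>0.$$ If $$T_1:=\max\left\{T_0,\frac{F(0)}{F'(0)},R\right\}\ge C_0A^{-(p-1)/(2M)},$$ then $$T<2^{2/M}T_1.$$
   Context: The inequality $F(t)\ge At^a$ is assumed at those times $t\ge T_0$ which lie in the interval $[0,T)$ on which $F$ is defined. $F\in C^2([0,T))$ includes one-sided derivatives at $t=0$. *)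

(* Defs.v *)
From HB Require Import structures.
From mathcomp Require Import all_boot all_order all_algebra.
From mathcomp Require Import all_classical all_reals all_analysis.
Set Implicit Arguments.
Unset Strict Implicit.
Unset Printing Implicit Defensive.
Import Order.TTheory GRing.Theory Num.Theory.
Import numFieldNormedType.Exports.
Local Open Scope classical_set_scope.
Local Open Scope ring_scope.

(* The interval [0, T), with T possibly infinite. *)
Definition half_open {K : realType} (T : \bar K) : set K :=
  [set t | 0 <= t /\ (t%:E < T)%E].

(* Derivatives relative to a set D: the difference quotient is taken only at
   points y of D different from x, so that at an endpoint of an interval the
   derivative is one-sided and values of f outside D play no role. *)
Definition diff_quotient {K : realType} (f : K -> K) (x y : K) : K :=
  (f y - f x) / (y - x).

Definition derivable_within {K : realType} (D : set K) (f : K -> K) (x : K) :=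
  cvg (diff_quotient f x y @[y --> within D x^']).

Definition deriv_within {K : realType} (D : set K) (f : K -> K) : K -> K :=
  fun x => lim (diff_quotient f x y @[y --> within D x^']).

(* Continuity of f and of its first derivative follows from derivability. *)
Definition C2_within {K : realType} (D : set K) (f : K -> K) : Prop :=
  [/\ forall x, D x -> derivable_within D f x,
      forall x, D x -> derivable_within D (deriv_within D f) x
    & {within D, continuous (deriv_within D (deriv_within D f))}].

(* Main.v *)
Require Import Defs.
From HB Require Import structures.
From mathcomp Require Import all_boot all_order all_algebra.
From mathcomp Require Import all_classical all_reals all_analysis.
From mathcomp Require Import ring lra.
Import Order.TTheory GRing.Theory Num.Theory.
Import numFieldNormedType.Exports.
Local Open Scope classical_set_scope.
Local Open Scope ring_scope.

(* Kato's method. F'' >= 0 and F' 0 > 0 make F convex and increasing, and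
   F t >= 2 F 0 once t >= F 0 / F' 0. Multiplying the inequality for F'' by F'
   and integrating over [0, t], with the decreasing weight (x + R)^(-q) frozen at
   x = t, gives the first-order inequality F' t >= D t^(-q/2) (F t)^((p+1)/2) for
   t >= T1. Spend all but a power F^(1+dl) of the right-hand side on the lower
   bound A t^a: then (- F^(-dl) / dl)' >= D A^((p-1)/2 - dl) t^(M - a dl - 1), and
   M - a dl > 0 for small dl. Integrating from T1 to 2^(1/M) T1 bounds
   A^((p-1)/2) T1^M by a constant that depends only on p, a, q, B; a large C0
   contradicts this. *)

(** * Calculus relative to a set, monotonicity and real powers *)

(** Every point close to an interior [x] lies in [D], so there the relative difference quotient is
    the ordinary one with increment [h = y - x]. *)
Lemma is_derive_within (K : realType) (D : set K) (f : K -> K) (x : K) :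
  nbhs x D -> derivable_within D f x -> is_derive x 1 f (deriv_within D f x).
Proof.
move=> Dx dfx.
have cf : (fun h : K => h^-1 *: ((f \o shift x) (h *: (1 : K)) - f x)) @ 0^'
    --> deriv_within D f x.
  have /cvgrPdist_lt fl : diff_quotient f x y @[y --> within D x^']
    --> deriv_within D f x by [].
  apply/cvgrPdist_lt => e e0; have /nbhs_ballP[/= d d0 xd] := fl _ e0.
  have /nbhs_ballP[/= d' d'0 xd'] := Dx.
  apply/nbhs_ballP; exists (Num.min d d'); first by rewrite /= lt_min d0 d'0.
  move=> h /= + h0; rewrite -ball_normE /ball_/= sub0r normrN lt_min.
  move=> /andP[hd hd'].
  have := xd (h + x); rewrite -ball_normE /ball_/= opprD addrCA subrr addr0.
  rewrite normrN /diff_quotient addrK => /(_ hd).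
  rewrite [h%:A]mulr1 [X in _ -> X]/= [_ *: _]mulrC; apply.
    by rewrite -subr_eq0 addrK.
  by apply: xd'; rewrite -ball_normE /ball_/= opprD addrCA subrr addr0 normrN.
by split; [exact: cvgP cf | exact: cvg_lim cf].
Qed.

(** For [y] in [D] other than [x], [f y] is [f x] plus the quotient times [y - x], and this product
    tends to 0; the case [y = x] is treated apart. At the endpoint 0 this gives one-sided
    continuity. *)
Lemma derivable_within_cvg (K : realType) (D : set K) (f : K -> K) (x : K) :
  derivable_within D f x -> f @ within D (nbhs x) --> f x.
Proof.
move=> dfx; pose F := within D x^'.
have cF (g : K -> K) l : g @ nbhs x --> l -> g @ F --> l.
  by move=> gl; apply: cvg_trans gl; apply: cvg_app;
    exact: cvg_trans (cvg_within _) (cvg_within _).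
have cf : f x + diff_quotient f x y * (y - x) @[y --> F] --> f x.
  rewrite -[X in _ --> X]addr0 -[X in _ --> _ + X](mulr0 (deriv_within D f x)).
  apply: cvgD; first exact: cvg_cst.
  apply: cvgM; first exact: dfx.
  by rewrite -(subrr x); apply: cF; apply: cvgB; [exact: cvg_id|exact: cvg_cst].
move=> A Ax; have Afx := nbhs_singleton Ax.
have cfA : nbhs x [set y | y != x -> D y ->
  A (f x + diff_quotient f x y * (y - x))] by exact: cf.
suff : nbhs x [set y | D y -> A (f y)] by [].
apply: filterS cfA => y /= Py Dy; have [->//|yx] := eqVneq y x.
by have := Py yx Dy; rewrite /diff_quotient divfK ?subr_eq0// addrC subrK.
Qed.

(** Asking for derivatives only in the open interval allows intervals that start at 0, where the
    derivative of F is one-sided. *)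
Lemma is_derive_ge0_le (K : realType) (f df : K -> K) (a b : K) : a <= b ->
  (forall x, a < x < b -> is_derive x 1 f (df x)) ->
  (forall x, a < x < b -> 0 <= df x) ->
  {within `[a, b], continuous f} -> f a <= f b.
Proof.
rewrite le_eqVlt => /predU1P[-> //|ab] fdf df0 cf.
have fdf' x : x \in `]a, b[ -> is_derive x 1 f (df x).
  by rewrite in_itv/=; exact: fdf.
have [c + fc] := MVT ab fdf' cf.
rewrite in_itv/= => abc; rewrite -subr_ge0 fc mulr_ge0 ?df0//.
by rewrite subr_ge0 ltW.
Qed.

Lemma is_derive_powR_comp (K : realType) (f : K -> K) (r x df : K) : 0 < f x ->
  is_derive x 1 f df ->
  is_derive x 1 (fun y => f y `^ r) (r * f x `^ (r - 1) * df).
Proof.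
move=> fx0 fdf.
have := @is_derive1_comp _ (fun y : K => y `^ r) f x _ _ (is_derive1_powR r fx0) fdf.
by rewrite mulrC.
Qed.

Lemma gt1_ltr_powR (K : realType) (a x y : K) :
  1 < a -> x < y -> a `^ x < a `^ y.
Proof.
by move=> a1 xy; rewrite /powR gt_eqF ?(lt_trans _ a1)// ltr_expR ltr_pM2r ?ln_gt0.
Qed.

(** * Energy estimate: from a second-order to a first-order inequality *)

(** [G] and [H] stand for F' and F''. The energy G^2/2 - c F^(p+1) is nondecreasing on [s, t]. Since
    F s <= 3/4 F t, this leaves (G t)^2/2 >= c/4 (F t)^(p+1), and t + R <= 2 t gives the stated
    constants. *)
Lemma first_order_ineq (K : realType) (B p q R t : K) (F G H : K -> K) :
  0 < B -> 1 < p -> 0 <= q -> 0 < R -> R <= t ->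
  {within `[0, t], continuous F} -> {within `[0, t], continuous G} ->
  (forall x, 0 < x < t -> is_derive x 1 F (G x)) ->
  (forall x, 0 < x < t -> is_derive x 1 G (H x)) ->
  (forall x, 0 < x < t -> B * (x + R) `^ (- q) * `|F x| `^ p <= H x) ->
  0 <= F 0 -> 0 < G 0 -> F 0 / G 0 <= t ->
  Num.sqrt (B / (2 * (p + 1))) * (2 * t) `^ (- (q / 2)) * F t `^ ((p + 1) / 2)
    <= G t.
Proof.
move=> B0 p1 q0 R0 Rt cF cG dF dG ineq F00 G00 FGt.
have t0 : 0 < t by exact: lt_le_trans Rt.
have H0 x : 0 < x < t -> 0 <= H x.
  move=> xt; apply: le_trans (ineq _ xt).
  by rewrite !mulr_ge0 ?powR_ge0// ltW.
have subcont (f : K -> K) x y : 0 <= x -> y <= t ->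
    {within `[0, t], continuous f} -> {within `[x, y], continuous f}.
  move=> x0 yt; apply: continuous_subspaceW => z/=; rewrite !in_itv/=.
  by case/andP=> xz zy; rewrite (le_trans x0 xz) (le_trans zy yt).
have Gmono x y : 0 <= x -> x <= y -> y <= t -> G x <= G y.
  move=> x0 xy yt; apply: (@is_derive_ge0_le _ _ H _ _ xy).
  - move=> z /andP[xz zy]; apply: dG.
    by rewrite (le_lt_trans x0 xz) (lt_le_trans zy yt).
  - move=> z /andP[xz zy]; apply: H0.
    by rewrite (le_lt_trans x0 xz) (lt_le_trans zy yt).
  - exact: subcont.
have Gpos x : 0 <= x -> x <= t -> 0 < G x.
  by move=> x0 xt; apply: lt_le_trans G00 _; exact: Gmono.
have cM (c : K) (A : set K) : {within A, continuous (fun y => y * c)}.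
  apply: continuous_subspaceT => y.
  by apply: cvgM; [exact: cvg_id|exact: cvg_cst].
(* [G] is nondecreasing, so F lies above its tangent at 0. *)
have Flow x : 0 <= x -> x <= t -> F 0 + x * G 0 <= F x.
  move=> x0 xt.
  have : F 0 - 0 * G 0 <= F x - x * G 0.
    apply: (@is_derive_ge0_le _ (fun z => F z - z * G 0)
      (fun z => G z - G 0) _ _ x0).
    - move=> z /andP[z0 zx].
      have dFz : is_derive z 1 F (G z).
        by apply: dF; rewrite z0 (lt_le_trans zx xt).
      by apply: is_derive_eq; rewrite /GRing.scale/=; ring.
    - move=> z /andP[z0 zx]; rewrite subr_ge0 Gmono// ltW//.
      exact: lt_le_trans xt.
    - move=> z; apply: cvgB; first exact: (subcont F _ _ _ _ cF z).
      exact: cM.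
  lra.
(* The final slope [G t] is the largest on [0, t]; this limits the growth of F near 0. *)
have Fup x : 0 <= x -> x <= t -> F x <= F 0 + x * G t.
  move=> x0 xt.
  have : 0 * G t - F 0 <= x * G t - F x.
    apply: (@is_derive_ge0_le _ (fun z => z * G t - F z)
      (fun z => G t - G z) _ _ x0).
    - move=> z /andP[z0 zx].
      have dFz : is_derive z 1 F (G z).
        by apply: dF; rewrite z0 (lt_le_trans zx xt).
      by apply: is_derive_eq; rewrite /GRing.scale/=; ring.
    - move=> z /andP[z0 zx]; rewrite subr_ge0 Gmono// ltW//.
      exact: lt_le_trans xt.
    - move=> z; apply: cvgB; last exact: (subcont F _ _ _ _ cF z).
      exact: cM.
  lra.
have Fpos x : 0 < x -> x <= t -> 0 < F x.
  move=> x0 xt; apply: lt_le_trans (Flow _ (ltW x0) xt).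
  by rewrite ltr_wpDl// mulr_gt0.
have Fmono x y : 0 <= x -> x <= y -> y <= t -> F x <= F y.
  move=> x0 xy yt; apply: (@is_derive_ge0_le _ _ G _ _ xy).
  - move=> z /andP[xz zy]; apply: dF.
    by rewrite (le_lt_trans x0 xz) (lt_le_trans zy yt).
  - move=> z /andP[xz zy]; rewrite ltW// Gpos//; first exact: le_trans (ltW xz).
    exact: le_trans (ltW zy) yt.
  - exact: subcont.
have Ft0 := Fpos _ t0 (lexx t).
have Gt0 := Gpos _ (ltW t0) (lexx t).
have F0t : F 0 <= F t / 2.
  have : F 0 <= t * G 0 by rewrite -ler_pdivrMr.
  have := Flow _ (ltW t0) (lexx t); lra.
(* The energy is compared on [s, t] with s > 0: F 0 may vanish, and y `^ (p + 1),
   which is 1 for y < 0, is not continuous at 0. *)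
have [s /andP[s0 st] Fs] : exists2 s, 0 < s <= t & F s <= 3 / 4 * F t.
  (* The second bound makes s G t <= F t / 4; added to F 0 <= F t / 2 it yields the factor 3/4. *)
  exists (Num.min t (F t / (4 * G t))).
    by rewrite lt_min t0 divr_gt0 ?mulr_gt0//= ge_min lexx.
  set s := Num.min _ _.
  have s0 : 0 <= s by rewrite le_min (ltW t0) divr_ge0 ?mulr_ge0 ?ltW.
  have st : s <= t by rewrite ge_min lexx.
  have := Fup s s0 st.
  have : s * (4 * G t) <= F t.
    by rewrite -ler_pdivlMr ?mulr_gt0// ge_min lexx orbT.
  lra.
pose c := B * (t + R) `^ (- q) / (p + 1).
have c0 : 0 < c.
  by rewrite /c divr_gt0 ?mulr_gt0 ?powR_gt0//; lra.
have energy : G s ^+ 2 / 2 - c * F s `^ (p + 1)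
    <= G t ^+ 2 / 2 - c * F t `^ (p + 1).
  apply: (@is_derive_ge0_le _ (fun z => G z ^+ 2 / 2 - c * F z `^ (p + 1))
    (fun z => G z * (H z - c * (p + 1) * F z `^ p)) _ _ st).
  - move=> z /andP[sz zt]; have z0 := lt_trans s0 sz.
    have dFz : is_derive z 1 F (G z) by apply: dF; rewrite z0.
    have dGz : is_derive z 1 G (H z) by apply: dG; rewrite z0.
    have dP := is_derive_powR_comp _ _ (p + 1) _ _ (Fpos _ z0 (ltW zt)) dFz.
    by apply: is_derive_eq; rewrite /GRing.scale/= addrK; field.
  - move=> z /andP[sz zt]; have z0 := lt_trans s0 sz.
    rewrite mulr_ge0 ?(ltW (Gpos _ (ltW z0) (ltW zt)))// subr_ge0.
    apply: le_trans (ineq z _); last by rewrite z0.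
    rewrite (ger0_norm (ltW (Fpos _ z0 (ltW zt)))) ler_wpM2r ?powR_ge0//.
    rewrite /c divfK; last by rewrite gt_eqF//; lra.
    rewrite ler_pM2l// !powRN lef_pV2 ?posrE ?powR_gt0//; try lra.
    by rewrite ge0_ler_powR ?nnegrE//; lra.
  - have cFP : {within `[s, t], continuous (fun z => F z `^ (p + 1))}.
      apply: (@within_continuous_comp _ _ _ _ F (fun y => y `^ (p + 1))).
        move=> _ /set_mem[z + <-]; rewrite /= in_itv/= => /andP[sz zt].
        apply: differentiable_continuous; apply/derivable1_diffP.
        apply: derivable_powR; rewrite in_itv/= andbT Fpos//.
        exact: lt_le_trans sz.
      exact: (subcont F s t (ltW s0) (lexx t) cF).
    have cGst := subcont G s t (ltW s0) (lexx t) cG.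
    have cG2 : {within `[s, t], continuous (fun z => G z ^+ 2)}.
      by move=> z; apply: continuousM; exact: cGst.
    move=> z; apply: cvgB; apply: cvgM;
      [exact: cG2|exact: cvg_cst|exact: cvg_cst|exact: cFP].
(* One factor F s carries the 3/4; monotonicity of F handles the remaining power p. *)
have Fp : F s `^ (p + 1) <= 3 / 4 * F t `^ (p + 1).
  have split x : 0 < x -> x `^ (p + 1) = x * x `^ p.
    by move=> x0; rewrite powRD ?(gt_eqF x0) ?implybT// powRr1 ?(ltW x0)// mulrC.
  have Fs0 := Fpos s s0 st.
  rewrite !split// mulrA; apply: ler_pM; rewrite ?powR_ge0 ?(ltW Fs0)//.
  rewrite ge0_ler_powR ?nnegrE ?(ltW Fs0) ?(ltW Ft0)//; first lra.
  by apply: Fmono => //; exact: ltW.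
have Gsq : c / 2 * F t `^ (p + 1) <= G t ^+ 2.
  have := sqr_ge0 (G s).
  have : c * F s `^ (p + 1) <= c * (3 / 4 * F t `^ (p + 1)).
    by rewrite ler_pM2l.
  lra.
rewrite -(@ler_pXn2r _ 2) ?nnegrE ?(ltW Gt0)//; last by rewrite !mulr_ge0 ?powR_ge0.
apply: le_trans Gsq.
have sqP (x r : K) : (x `^ (r / 2)) ^+ 2 = x `^ r.
  by rewrite -powR_mulrn ?powR_ge0// -powRrM divfK.
rewrite !exprMn -mulNr !sqP sqr_sqrtr; last by rewrite divr_ge0 ?mulr_ge0; lra.
rewrite ler_wpM2r ?powR_ge0//.
have -> : c / 2 = B / (2 * (p + 1)) * (t + R) `^ (- q).
  by rewrite /c; field; rewrite gt_eqF//; lra.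
rewrite ler_wpM2l//; first by rewrite divr_ge0//; lra.
rewrite !powRN lef_pV2 ?posrE ?powR_gt0//; try lra.
by rewrite ge0_ler_powR ?nnegrE//; lra.
Qed.

(** * Integration of the first-order inequality *)

(** The term with F t1 has a favourable sign and is dropped, and F T1 is bounded below by A T1^a, so
    F disappears from the conclusion. *)
Lemma blowup_ineq (K : realType) (A D a p q M dl T1 t1 : K) (F G : K -> K) :
  M = (p - 1) / 2 * a - q / 2 + 1 ->
  0 < A -> 0 <= D -> 0 < dl -> dl <= (p - 1) / 2 -> 0 < M - a * dl ->
  0 < T1 -> T1 <= t1 ->
  {within `[T1, t1], continuous F} ->
  (forall x, T1 < x < t1 -> is_derive x 1 F (G x)) ->
  (forall x, T1 <= x <= t1 -> A * x `^ a <= F x) ->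
  (forall x, T1 < x < t1 ->
    D * x `^ (- (q / 2)) * F x `^ ((p + 1) / 2) <= G x) ->
  dl * D * A `^ ((p - 1) / 2) * T1 `^ (a * dl)
    * (t1 `^ (M - a * dl) - T1 `^ (M - a * dl)) <= M - a * dl.
Proof.
move=> ME A0 D0 dl0 dlp m0 T10 Tt cF dF Flow Gineq.
set m := M - a * dl in m0 *; pose k := (p - 1) / 2 - dl.
have k0 : 0 <= k by rewrite subr_ge0.
pose E := D * A `^ k.
have lowpos x : T1 <= x -> 0 < x /\ 0 < A * x `^ a.
  by move=> Tx; have x0 := lt_le_trans T10 Tx; rewrite mulr_gt0 ?powR_gt0.
have Fpos x : T1 <= x <= t1 -> 0 < F x.
  move=> /[dup] /andP[/lowpos[_ Ax] _] xT; exact: lt_le_trans (Flow _ xT).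
(* Integrated form of (- F^(-dl) / dl)' >= E z^(m-1). *)
have mono : - (dl^-1 * F T1 `^ (- dl)) - E / m * T1 `^ m
    <= - (dl^-1 * F t1 `^ (- dl)) - E / m * t1 `^ m.
  apply: (@is_derive_ge0_le _
    (fun z => - (dl^-1 * F z `^ (- dl)) - E / m * z `^ m)
    (fun z => F z `^ (- dl - 1) * G z - E * z `^ (m - 1)) _ _ Tt).
  - move=> z zT; have zT' : T1 <= z <= t1 by case/andP: zT => /ltW-> /ltW->.
    have z0 : 0 < z by case/andP: zT' => /lowpos[].
    have dP := is_derive_powR_comp _ _ (- dl) _ _ (Fpos _ zT') (dF _ zT).
    have dQ := is_derive1_powR m z0.
    apply: is_derive_eq; rewrite /GRing.scale/=; field.
    by rewrite !gt_eqF.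
  - move=> z zT; have zT' : T1 <= z <= t1 by case/andP: zT => /ltW-> /ltW->.
    have [z0 Az] : 0 < z /\ 0 < A * z `^ a by case/andP: zT' => /lowpos.
    have Fz := Fpos _ zT'.
    rewrite subr_ge0; apply: le_trans (_ : F z `^ (- dl - 1) *
      (D * z `^ (- (q / 2)) * F z `^ ((p + 1) / 2)) <= _); last first.
      by rewrite ler_wpM2l ?powR_ge0// Gineq.
    have -> : F z `^ (- dl - 1) * (D * z `^ (- (q / 2)) * F z `^ ((p + 1) / 2))
        = D * z `^ (- (q / 2)) * F z `^ k.
      have -> : F z `^ k = F z `^ (- dl - 1) * F z `^ ((p + 1) / 2).
        rewrite -powRD ?(gt_eqF Fz) ?implybT//; congr (_ `^ _).
        by rewrite /k; field.
      by ring.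
    have -> : E * z `^ (m - 1) = D * z `^ (- (q / 2)) * (A * z `^ a) `^ k.
      (* The definition of M enters here: - q/2 + a k = m - 1. *)
      have -> : z `^ (m - 1) = z `^ (- (q / 2)) * z `^ (a * k).
        rewrite -powRD ?(gt_eqF z0) ?implybT//; congr (_ `^ _).
        by rewrite /m /k ME; field.
      by rewrite powRM ?powR_ge0 ?(ltW A0)// -powRrM /E; ring.
    rewrite ler_wpM2l ?mulr_ge0 ?powR_ge0//.
    by rewrite ge0_ler_powR ?nnegrE ?(ltW Az) ?(ltW Fz)// Flow.
  - have cP (r : K) : {within `[T1, t1], continuous (fun z => F z `^ r)}.
      apply: (@within_continuous_comp _ _ _ _ F (fun y => y `^ r)) => //.
      move=> _ /set_mem[z + <-]; rewrite /= in_itv/= => zT.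
      apply: differentiable_continuous; apply/derivable1_diffP.
      by apply: derivable_powR; rewrite in_itv/= andbT Fpos.
    have cQ : {within `[T1, t1], continuous (fun z : K => z `^ m)}.
      apply: derivable_within_continuous => z.
      rewrite in_itv/= => /andP[/lowpos[z0 _] _].
      by apply: derivable_powR; rewrite in_itv/= andbT.
    move=> z; apply: cvgB; first apply: cvgN; apply: cvgM;
      [exact: cvg_cst|exact: cP|exact: cvg_cst|exact: cQ].
have TT : T1 <= T1 <= t1 by rewrite lexx.
have FT : F T1 `^ (- dl) <= A `^ (- dl) * T1 `^ (- (a * dl)).
  have [_ AT] := lowpos _ (lexx T1).
  rewrite -[- (a * dl)]mulrN powRrM -powRM ?powR_ge0 ?(ltW A0)//.
  rewrite !powRN lef_pV2 ?posrE ?powR_gt0 ?Fpos//.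
  by rewrite ge0_ler_powR ?nnegrE ?(ltW AT) ?(ltW (Fpos _ TT)) ?(ltW dl0)// Flow.
have Ft : 0 <= dl^-1 * F t1 `^ (- dl) by rewrite mulr_ge0 ?powR_ge0// invr_ge0 ltW.
have main : E / m * (t1 `^ m - T1 `^ m)
    <= dl^-1 * (A `^ (- dl) * T1 `^ (- (a * dl))).
  have : dl^-1 * F T1 `^ (- dl) <= dl^-1 * (A `^ (- dl) * T1 `^ (- (a * dl))).
    by rewrite ler_wpM2l// invr_ge0 ltW.
  by rewrite mulrBr; lra.
(* This multiplier clears the denominators m and dl and the negative powers of A and T1 in
   [main]. *)
have w0 : 0 <= m * dl * (A `^ dl * T1 `^ (a * dl)).
  by rewrite !mulr_ge0 ?powR_ge0 ?(ltW dl0) ?(ltW m0).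
have := ler_wpM2l w0 main.
have -> : A `^ ((p - 1) / 2) = A `^ dl * A `^ k.
  rewrite -powRD ?(gt_eqF A0) ?implybT//; congr (_ `^ _).
  by rewrite /k; ring.
rewrite !powRN /E.
set x1 := t1 `^ m; set x2 := T1 `^ m; set x3 := T1 `^ (a * dl).
set x4 := A `^ dl; set x5 := A `^ k.
have x30 : x3 != 0 by rewrite gt_eqF ?powR_gt0.
have x40 : x4 != 0 by rewrite gt_eqF ?powR_gt0.
have m0' := lt0r_neq0 m0; have dl0' := lt0r_neq0 dl0.
have -> : m * dl * (x4 * x3) * (dl^-1 * (x4^-1 * x3^-1)) = m.
  by field; rewrite x30 x40.
suff -> : m * dl * (x4 * x3) * (D * x5 / m * (x1 - x2))
  = dl * D * (x4 * x5) * x3 * (x1 - x2) by [].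
by field.
Qed.

(** * Choice of constants and contradiction *)

Theorem lemma2p1 (K : realType) (p a q B : K) :
  let M := (p - 1) / 2 * a - q / 2 + 1 in
  1 < p -> 0 < a -> 0 < q -> 0 < M -> 0 < B ->
  exists C0 : K, 0 < C0 /\
  forall (A R T0 : K) (T : \bar K) (F : K -> K),
    let F' := deriv_within (half_open T) F in
    let F'' := deriv_within (half_open T) F' in
    let T1 := Num.max T0 (Num.max (F 0 / F' 0) R) in
    0 < A -> 0 < R -> 0 < T0 -> (0 < T)%E ->
    C2_within (half_open T) F ->
    (forall t : K, T0 <= t -> (t%:E < T)%E -> A * t `^ a <= F t) ->
    (forall t : K, 0 <= t -> (t%:E < T)%E ->
       B * (t + R) `^ (- q) * `|F t| `^ p <= F'' t) ->
    0 <= F 0 ->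
    0 < F' 0 ->
    C0 * A `^ (- ((p - 1) / (2 * M))) <= T1 ->
    (T < (2 `^ (2 / M) * T1)%:E)%E.
Proof.
move=> M p1 a0 q0 M0 B0.
(* The first bound gives a dl <= M/2, so M - a dl stays positive; the second keeps the exponent
   (p-1)/2 - dl nonnegative. *)
pose dl := Num.min (M / (2 * a)) ((p - 1) / 2).
have dl0 : 0 < dl by rewrite lt_min !divr_gt0 ?mulr_gt0//; lra.
have dlp : dl <= (p - 1) / 2 by rewrite ge_min lexx orbT.
have m0 : 0 < M - a * dl.
  have : dl * (2 * a) <= M by rewrite -ler_pdivlMr ?mulr_gt0// ge_min lexx.
  lra.
set m := M - a * dl in m0.
(* With half the exponent 2/M, the time t1 = s T1 lies strictly below 2^(2/M) T1, hence inside [0,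
   T) if the conclusion fails. *)
pose s : K := 2 `^ (M^-1).
have s1 : 1 < s.
  by rewrite -[X in X < _](powRr0 2) gt1_ltr_powR ?invr_gt0// ltr1n.
have s0 : 0 < s by apply: lt_trans s1.
have sm1 : 1 < s `^ m by rewrite -[X in X < _](powRr0 s) gt1_ltr_powR.
pose D := Num.sqrt (B / (2 * (p + 1))) * 2 `^ (- (q / 2)).
have D0 : 0 < D.
  by rewrite mulr_gt0 ?powR_gt0// sqrtr_gt0 divr_gt0 ?mulr_gt0//; lra.
(* Twice the upper bound that [blowup_ineq] puts on A^((p-1)/2) T1^M; the factor 2 makes the
   contradiction strict. *)
pose L := 2 * m / (dl * D * (s `^ m - 1)).
have s'0 : 0 < s `^ m - 1 by rewrite subr_gt0.
have L0 : 0 < L by apply: divr_gt0; [exact: mulr_gt0|do 2?apply: mulr_gt0].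
(* Raised to the power M, the hypothesis on T1 then reads A^((p-1)/2) T1^M >= L. *)
exists (L `^ M^-1); split; first exact: powR_gt0.
move=> A R T0 T F F' F'' T1 A0 R0 T00 TT0 [dF dF' _] Flow Fineq F00 F'00 T1ge.
rewrite ltNge; apply/negP => TT1.
have T10 : 0 < T1 by rewrite lt_max T00.
have T0T1 : T0 <= T1 by rewrite le_max lexx.
have [FT1 RT1] : F 0 / F' 0 <= T1 /\ R <= T1.
  by rewrite !le_max !lexx !orbT.
pose t1 := s * T1.
have Tt1 : T1 <= t1 by rewrite ler_peMl// ltW.
have t1T : (t1%:E < T)%E.
  apply: lt_le_trans TT1; rewrite lte_fin ltr_pM2r// gt1_ltr_powR ?ltr1n//.
  by rewrite -[X in X < _]mul1r ltr_pM2r ?invr_gt0// ltr1n.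
have inT x : x <= t1 -> (x%:E < T)%E.
  by move=> xt; apply: le_lt_trans t1T; rewrite lee_fin.
have nbhsD x : 0 < x < t1 -> nbhs x (half_open T).
  move=> xt; have : nbhs x `]0, t1[%classic.
    by apply: open_nbhs_nbhs; split; [exact: interval_open|rewrite /= in_itv].
  apply: filterS => y; rewrite /= in_itv/= => /andP[y0 yt].
  by split; [exact: ltW|apply: inT; exact: ltW].
have Dpt x : 0 <= x -> x <= t1 -> half_open T x.
  by move=> x0 xt; split=> //; exact: inT.
have deriv (f : K -> K) x :
    (forall y, half_open T y -> derivable_within (half_open T) f y) ->
    0 < x < t1 -> is_derive x 1 f (deriv_within (half_open T) f x).
  move=> df /[dup] xt /andP[x0 xt1]; apply: is_derive_within; first exact: nbhsD.
  by apply: df; apply: Dpt; exact: ltW.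
have cont (f : K -> K) x y :
    (forall y, half_open T y -> derivable_within (half_open T) f y) ->
    0 <= x -> y <= t1 -> {within `[x, y], continuous f}.
  move=> df x0 yt; apply: (@continuous_subspaceW _ _ _ (half_open T)).
    move=> z; rewrite /= in_itv/= => /andP[xz zy].
    by apply: Dpt; [exact: le_trans xz|exact: le_trans yt].
  by apply/subspace_continuousP => z /df; exact: derivable_within_cvg.
(* The energy estimate holds at the final time of an interval; each x in [T1, t1] serves as one,
   since T1 dominates both R and F 0 / F' 0. *)
have first x : T1 <= x <= t1 ->
    D * x `^ (- (q / 2)) * F x `^ ((p + 1) / 2) <= F' x.
  move=> /andP[Tx xt]; have x0 : 0 <= x := ltW (lt_le_trans T10 Tx).
  rewrite /D -[X in X * _ <= _]mulrA -powRM//.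
  have sub y : 0 < y < x -> 0 < y < t1.
    by case/andP=> -> /lt_le_trans ->.
  apply: (@first_order_ineq _ B p q R x F F' F'') => //.
  - exact: ltW.
  - exact: le_trans Tx.
  - exact: cont.
  - exact: cont.
  - by move=> y /sub yt; exact: deriv.
  - by move=> y /sub yt; exact: deriv.
  - by move=> y /sub /andP[y0 yt]; apply: Fineq; [|apply: inT]; exact: ltW.
  - exact: le_trans Tx.
have := @blowup_ineq K A D a p q M dl T1 t1 F F' erefl A0 (ltW D0) dl0 dlp m0
  T10 Tt1 (cont _ _ _ dF (ltW T10) (lexx t1)).
have h1 x : T1 < x < t1 -> is_derive x 1 F (F' x).
  by move=> /andP[Tx xt]; apply: deriv => //; rewrite xt (lt_trans T10 Tx).
have h2 x : T1 <= x <= t1 -> A * x `^ a <= F x.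
  move=> /andP[Tx xt]; apply: Flow; first exact: le_trans Tx.
  exact: inT.
have h3 x : T1 < x < t1 -> D * x `^ (- (q / 2)) * F x `^ ((p + 1) / 2) <= F' x.
  by move=> /andP[/ltW Tx /ltW xt]; apply: first; rewrite Tx.
move=> /(_ h1 h2 h3); rewrite -/m.
(* As t1 is a fixed multiple of T1, the left side is homogeneous in T1, of degree a dl + m = M. *)
have -> : dl * D * A `^ ((p - 1) / 2) * T1 `^ (a * dl) * (t1 `^ m - T1 `^ m)
    = dl * D * (s `^ m - 1) * (A `^ ((p - 1) / 2) * T1 `^ M).
  have -> : T1 `^ M = T1 `^ (a * dl) * T1 `^ m.
    rewrite -powRD ?(gt_eqF T10) ?implybT//; congr (_ `^ _).
    by rewrite /m; ring.
  by rewrite powRM ?(ltW s0) ?(ltW T10)//; ring.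
apply/negP; rewrite -ltNge.
have LA : L <= A `^ ((p - 1) / 2) * T1 `^ M.
  have e : (L `^ M^-1 * A `^ (- ((p - 1) / (2 * M)))) `^ M <= T1 `^ M.
    by rewrite ge0_ler_powR ?nnegrE ?(ltW M0) ?(ltW T10)// mulr_ge0 ?powR_ge0.
  move: e; rewrite powRM ?powR_ge0// -!powRrM mulVf ?gt_eqF// powRr1 ?(ltW L0)//.
  have -> : - ((p - 1) / (2 * M)) * M = - ((p - 1) / 2) by field; rewrite gt_eqF.
  by rewrite powRN ler_pdivrMr ?powR_gt0// mulrC.
apply: lt_le_trans (_ : dl * D * (s `^ m - 1) * L <= _); last first.
  by rewrite ler_wpM2l// !mulr_ge0 ?(ltW dl0) ?(ltW D0)// subr_ge0 ltW.
rewrite /L mulrC divfK; first lra.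
by apply: lt0r_neq0; do 2?apply: mulr_gt0.
Qed.
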